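(* Let $Z=z_1e_1+z_2e_2$ and $\mathcal V=\nu_1e_1+\nu_2e_2$ be elements of $\mathbb{BC}$ (idempotent representations). Then the idempotent form of the bicomplex Bessel function is $$\mathcal J_{\mathcal V}(Z)=J_{\nu_1}(z_1)e_1+J_{\nu_2}(z_2)e_2,$$ and the series of $Z^{-\mathcal V}\mathcal J_{\mathcal V}(Z)$, that is, $$2^{-\mathcal V}\sum_{s=0}^{\infty}\frac{(-1)^s}{\Gamma_b(\mathcal V+s+1)\,s!}\left(\frac Z2\right)^{2s},$$ converges absolutely in the hyperbolic sense for all $Z\in\mathbb{BC}$.
   Context: Bicomplex numbers: $\mathbb{BC}=\{\lambda_1+j\lambda_2:\lambda_1,\lambda_2\in\mathbb C(i)\}$ with commuting units $i,j$, $i^2=j^2=-1$, $k=ij$, $k^2=1$. Put $e_1=\frac{1+k}{2}$, $e_2=\frac{1-k}{2}$; then $e_1+e_2=1$, $e_l^2=e_l$, $e_1e_2=0$. Every $Z=\lambda_1+j\lambda_2$ has the unique idempotent representation $Z=z_1e_1+z_2e_2$ with $z_1=\lambda_1-i\lambda_2$, $z_2=\lambda_1+i\lambda_2\in\mathbb C(i)$. The hyperbolic norm is $|Z|_h=|z_1|e_1+|z_2|e_2$. A bicomplex series $\sum_s A_s$ converges absolutely in the hyperbolic sense if $\sum_s|A_s|_h$ converges, i.e. if the series of both idempotent components converge absolutely. Powers and Gamma: $Z^{\mathcal V}=z_1^{\nu_1}e_1+z_2^{\nu_2}e_2$, with complex powers $z^\nu=\exp(\nu\log z)$ for a fixed branch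 of $\log$ used consistently (at $z=0$ only when the power makes sense). $\Gamma_b(Z)=\Gamma(z_1)e_1+\Gamma(z_2)e_2$; reciprocals $1/\Gamma$ are read as the entire function $1/\Gamma$ (zero at the poles of $\Gamma$), and a term whose coefficient is zero is zero. Bicomplex Bessel function: for $\mathcal V,Z\in\mathbb{BC}$, $$\mathcal J_{\mathcal V}(Z)=\sum_{s=0}^\infty\frac{(-1)^s}{\Gamma_b(\mathcal V+s+1)s!}\left(\frac Z2\right)^{\mathcal V+2s}.$$ Classical Bessel function: $J_\nu(z)=\sum_{n=0}^\infty\frac{(-1)^n}{n!\,\Gamma(\nu+n+1)}\left(\frac z2\right)^{2n+\nu}$, $\nu,z\in\mathbb C$. *)

(* Defs.v *)
From Stdlib Require Import Reals Factorial ClassicalEpsilon.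
From Coquelicot Require Import Coquelicot.

Open Scope C_scope.

(** * Values of limits and of series *)

(* The limit of [u] when it exists, an arbitrary element otherwise.
   [is_series a l] unfolds to convergence of [sum_n a] to [l], so
   [sum_series a] is the sum of the series whenever it converges. *)
Definition lim_value {T : UniformSpace} (x0 : T) (u : nat -> T) : T :=
  epsilon (inhabits x0) (fun l => filterlim u eventually (locally l)).

Definition sum_series {K : AbsRing} {V : NormedModule K} (a : nat -> V) : V :=
  lim_value (zero : V) (sum_n a).

(** * Complex exponential, logarithms and powers *)

Definition Cexp (z : C) : C :=
  RtoC (exp (Re z)) * (cos (Im z), sin (Im z)).

(* Any choice of a logarithm of each nonzero number: this covers the principal
   branch and every other branch, whatever its cut and its values there. *)
Definition is_log_branch (L : C -> C) : Prop :=
  forall z : C, z <> 0 -> Cexp (L z) = z.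

(* [0 ^ 0 = 1] and [0 ^ nu = 0] for [nu <> 0]; the latter is the usual value
   when [Re nu > 0] and a conventional one in the cases where the power of [0]
   does not make sense. *)
Definition Cpower (L : C -> C) (z nu : C) : C :=
  if Ceq_dec z 0 then (if Ceq_dec nu 0 then 1 else 0)
  else Cexp (nu * L z).

(** * The Gamma function *)

(* rising z n = z (z + 1) ... (z + n - 1) *)
Fixpoint rising (z : C) (n : nat) : C :=
  match n with
  | O => 1
  | S m => rising z m * (z + RtoC (INR m))
  end.

(* Gauss' product for the entire function 1 / Gamma:
   1 / Gamma(z) = lim_n  z (z + 1) ... (z + n) / (n! n^z). *)
Definition inv_Gamma (z : C) : C :=
  lim_value (0 : C) (fun n : nat =>
    rising z (S n) / (RtoC (INR (fact n)) * Cexp (z * RtoC (ln (INR n))))).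

(* At a pole of Gamma this is [/ 0 = 0], so that [/ Gamma z] is the entire
   function at every [z], with no side condition: see [Cinv_Gamma]. *)
Definition Gamma (z : C) : C := / inv_Gamma z.

Lemma Cinv_0 : / (0 : C) = 0.
Proof.
apply injective_projections; simpl; unfold Rdiv; ring.
Qed.

Lemma Cinv_Gamma (z : C) : / Gamma z = inv_Gamma z.
Proof.
unfold Gamma; destruct (Ceq_dec (inv_Gamma z) 0) as [E | E].
- now rewrite E, !Cinv_0.
- now field.
Qed.

(** * The classical Bessel function *)

Definition BesselJ_term (L : C -> C) (nu z : C) (n : nat) : C :=
  (- (1)) ^ n / (RtoC (INR (fact n)) * Gamma (nu + RtoC (INR n) + 1))
  * Cpower L (z / 2) (2 * RtoC (INR n) + nu).

Definition BesselJ (L : C -> C) (nu z : C) : C :=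
  sum_series (K := C_AbsRing) (V := C_NormedModule) (BesselJ_term L nu z).

(** * Bicomplex numbers *)

(* The pair [(l1, l2)] stands for [l1 + j l2]. *)
Definition BC : Type := (C * C)%type.

Definition BC_NormedModule : NormedModule C_AbsRing :=
  prod_NormedModule C_AbsRing C_NormedModule C_NormedModule.

Definition CtoBC (z : C) : BC := (z, RtoC 0).
Definition BCj : BC := (RtoC 0, RtoC 1).

Definition BCplus (Z W : BC) : BC := (fst Z + fst W, snd Z + snd W).
Definition BCopp (Z : BC) : BC := (- fst Z, - snd Z).
Definition BCmult (Z W : BC) : BC :=
  (fst Z * fst W - snd Z * snd W, fst Z * snd W + snd Z * fst W).

Declare Scope BC_scope.
Delimit Scope BC_scope with BC.
Bind Scope BC_scope with BC.
Infix "+" := BCplus : BC_scope.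
Notation "- Z" := (BCopp Z) : BC_scope.
Notation "Z - W" := (BCplus Z (BCopp W)) : BC_scope.
Infix "*" := BCmult : BC_scope.

Fixpoint BCpow_nat (Z : BC) (n : nat) : BC :=
  match n with
  | O => CtoBC 1
  | S m => (Z * BCpow_nat Z m)%BC
  end.

Definition BCk : BC := (CtoBC Ci * BCj)%BC.
Definition BCe1 : BC := (CtoBC (/ 2) * (CtoBC 1 + BCk))%BC.
Definition BCe2 : BC := (CtoBC (/ 2) * (CtoBC 1 - BCk))%BC.

Definition idem (z1 z2 : C) : BC := (CtoBC z1 * BCe1 + CtoBC z2 * BCe2)%BC.
Definition idem1 (Z : BC) : C := fst Z - Ci * snd Z.
Definition idem2 (Z : BC) : C := fst Z + Ci * snd Z.

Lemma idemK (Z : BC) : idem (idem1 Z) (idem2 Z) = Z.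
Proof.
destruct Z as [[a b] [c d]].
apply injective_projections; apply injective_projections; simpl; field.
Qed.

Lemma idem1_idem (z1 z2 : C) : idem1 (idem z1 z2) = z1.
Proof.
destruct z1 as [a b], z2 as [c d].
apply injective_projections; simpl; field.
Qed.

Lemma idem2_idem (z1 z2 : C) : idem2 (idem z1 z2) = z2.
Proof.
destruct z1 as [a b], z2 as [c d].
apply injective_projections; simpl; field.
Qed.

Lemma idem_mult (z1 z2 w1 w2 : C) :
  (idem z1 z2 * idem w1 w2)%BC = idem (z1 * w1) (z2 * w2).
Proof.
destruct z1 as [a b], z2 as [c d], w1 as [a' b'], w2 as [c' d'].
apply injective_projections; apply injective_projections; simpl; field.
Qed.

(* The inverse of [Z] when both idempotent components are nonzero; in general
   each component is inverted with the convention [/ 0 = 0], as needed to read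
   [1 / Gamma_b] through the entire function 1 / Gamma in each component. *)
Definition BCinv (Z : BC) : BC := idem (/ idem1 Z) (/ idem2 Z).
Notation "Z / W" := (BCmult Z (BCinv W)) : BC_scope.

Lemma BCinv_r (Z : BC) :
  idem1 Z <> 0 -> idem2 Z <> 0 -> (Z * BCinv Z)%BC = CtoBC 1.
Proof.
intros H1 H2; rewrite <- (idemK Z) at 1; unfold BCinv.
rewrite idem_mult, !Cinv_r by assumption.
apply injective_projections; apply injective_projections; simpl; field.
Qed.

(* The hyperbolic norm takes its values among the bicomplex numbers whose
   idempotent components are nonnegative reals. *)
Definition BCnorm_h (Z : BC) : BC :=
  idem (RtoC (Cmod (idem1 Z))) (RtoC (Cmod (idem2 Z))).

Definition abs_converges_h (A : nat -> BC) : Prop :=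
  ex_series (K := C_AbsRing) (V := BC_NormedModule)
    (fun s => BCnorm_h (A s)).

Definition BCpower (L : C -> C) (Z V : BC) : BC :=
  idem (Cpower L (idem1 Z) (idem1 V)) (Cpower L (idem2 Z) (idem2 V)).

Definition Gamma_b (Z : BC) : BC := idem (Gamma (idem1 Z)) (Gamma (idem2 Z)).

(** * The bicomplex Bessel function *)

Definition BCnat (n : nat) : BC := CtoBC (RtoC (INR n)).

Definition BesselJ_b_coef (V : BC) (s : nat) : BC :=
  (BCpow_nat (- CtoBC 1) s
   / (Gamma_b (V + BCnat s + CtoBC 1) * BCnat (fact s)))%BC.

Definition BesselJ_b_term (L : C -> C) (V Z : BC) (s : nat) : BC :=
  (BesselJ_b_coef V s * BCpower L (Z / CtoBC 2) (V + CtoBC 2 * BCnat s))%BC.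

Definition BesselJ_b (L : C -> C) (V Z : BC) : BC :=
  sum_series (K := C_AbsRing) (V := BC_NormedModule) (BesselJ_b_term L V Z).

(* Terms of 2^(-V) sum_s (-1)^s / (Gamma_b(V + s + 1) s!) (Z / 2)^(2 s). *)
Definition BesselJ_b_normalized_term (L : C -> C) (V Z : BC) (s : nat) : BC :=
  (BCpower L (CtoBC 2) (- V)
   * (BesselJ_b_coef V s * BCpow_nat (Z / CtoBC 2) (2 * s)))%BC.

(* Main.v *)
(* In idempotent coordinates sums, products, powers and limits are computed
   componentwise, so everything reduces to the convergence of the classical
   series. For that, the quotients of two successive terms of Gauss' product
   are [1 + O(1/n^2)], so the product converges for every [z] and its limit
   satisfies [1/Gamma(z) = z / Gamma(z + 1)]. Hence [|1/Gamma(nu + n + 1)|] is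
   eventually decreasing in [n], and the Bessel series is dominated by an
   exponential series, including at [z = 0] and for negative integers [nu]. *)

Require Import Defs.
From Stdlib Require Import Reals Lra Lia Factorial ClassicalEpsilon.
From Coquelicot Require Import Coquelicot.

Open Scope R_scope.

(** * Estimates for the real and the complex exponential *)

Lemma exp_le (x y : R) : x <= y -> exp x <= exp y.
Proof.
intros [H | ->]; [left; now apply exp_increasing | apply Rle_refl].
Qed.

Lemma exp_minus_1_bound (x : R) : Rabs (exp x - 1) <= Rabs x * exp (Rabs x).
Proof.
pose proof (exp_ineq1_le x) as H1; pose proof (exp_ineq1_le (- x)) as H2.
pose proof (exp_pos x) as H3.
assert (H4 : exp x * exp (- x) = 1) by (rewrite <- exp_plus, Rplus_opp_r; apply exp_0).
destruct (Rle_dec 0 x) as [Hx | Hx].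
- rewrite !(Rabs_pos_eq x) by lra.
  apply Rabs_le; split; nra.
- rewrite (Rabs_left x) by lra.
  assert (exp x < 1) by (rewrite <- exp_0; apply exp_increasing; lra).
  pose proof (exp_ineq1_le (- x)).
  apply Rabs_le; split; nra.
Qed.

(** Multiplying [1 - x <= exp (- x)] by [exp x] gives [exp x - 1 <= x * exp x], so the remainder,
    which is nonnegative, is at most [x * (exp x - 1)]; the first-order bound then finishes. *)
Lemma exp_minus_1_minus_bound (x : R) :
  Rabs (exp x - 1 - x) <= x ^ 2 * exp (Rabs x).
Proof.
pose proof (exp_ineq1_le x) as H1; pose proof (exp_ineq1_le (- x)) as H2.
pose proof (exp_pos x) as H3.
assert (H4 : exp x * exp (- x) = 1) by (rewrite <- exp_plus, Rplus_opp_r; apply exp_0).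
pose proof (exp_minus_1_bound x) as H5.
rewrite (Rabs_pos_eq (exp x - 1 - x)) by lra.
apply Rle_trans with (x * (exp x - 1)); [nra |].
apply Rle_trans with (Rabs (x * (exp x - 1))); [apply Rle_abs |].
rewrite Rabs_mult, <- (pow2_abs x).
pose proof (Rabs_pos x); nra.
Qed.

Lemma Rabs_sin_le (y : R) : Rabs (sin y) <= Rabs y.
Proof.
destruct (MVT_gen sin 0 y cos) as [c [_ Hc]].
- intros; apply is_derive_Reals, derivable_pt_lim_sin.
- intros; apply continuity_sin.
- rewrite sin_0, !Rminus_0_r in Hc.
  rewrite Hc, Rabs_mult.
  pose proof (Rabs_pos y); pose proof (COS_bound c).
  assert (Rabs (cos c) <= 1) by (apply Rabs_le; lra).
  nra.
Qed.

Lemma cos_minus_1 (y : R) : cos y - 1 = - (2 * (sin (y / 2)) ^ 2).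
Proof.
replace y with (2 * (y / 2)) at 1 by field.
rewrite cos_2a_sin; ring.
Qed.

Lemma cos_minus_1_bound (y : R) : Rabs (cos y - 1) <= y ^ 2.
Proof.
rewrite cos_minus_1, Rabs_Ropp, Rabs_pos_eq by nra.
pose proof (Rabs_sin_le (y / 2)) as H.
apply Rsqr_le_abs_1 in H; unfold Rsqr in H; nra.
Qed.

Lemma cos_minus_1_bound_linear (y : R) : Rabs (cos y - 1) <= Rabs y.
Proof.
rewrite cos_minus_1, Rabs_Ropp, Rabs_pos_eq by nra.
pose proof (Rabs_sin_le (y / 2)) as H.
pose proof (SIN_bound (y / 2)) as H1.
assert (H2 : Rabs (sin (y / 2)) <= 1) by (apply Rabs_le; lra).
rewrite <- pow2_abs; pose proof (Rabs_pos (sin (y / 2))).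
unfold Rdiv in H at 2; rewrite Rabs_mult, (Rabs_pos_eq (/ 2)) in H by lra.
nra.
Qed.

(** Mean value theorem for [sin y - y]: its derivative [cos c - 1] at an intermediate point is at
    most [Rabs c <= Rabs y] in absolute value. *)
Lemma sin_minus_id_bound (y : R) : Rabs (sin y - y) <= y ^ 2.
Proof.
destruct (MVT_gen (fun y => sin y - y) 0 y (fun y => cos y - 1)) as [c [Hy Hc]].
- intros; auto_derive; [easy | ring].
- intros; apply (continuity_pt_minus sin id).
  + apply continuity_sin.
  + apply derivable_continuous_pt, derivable_pt_id.
- rewrite sin_0, !Rminus_0_r in Hc.
  rewrite Hc, Rabs_mult, <- (pow2_abs y).
  assert (Rabs c <= Rabs y).
  { revert Hy; unfold Rmin, Rmax, Rabs.
    destruct (Rle_dec 0 y), (Rcase_abs c), (Rcase_abs y); lra. }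
  pose proof (cos_minus_1_bound_linear c).
  pose proof (Rabs_pos y); nra.
Qed.

Lemma Cmod_le_sum (w : C) : Cmod w <= Rabs (Re w) + Rabs (Im w).
Proof.
destruct w as [x y]; unfold Cmod; simpl fst; simpl snd; unfold Re, Im; simpl fst; simpl snd.
pose proof (Rabs_pos x); pose proof (Rabs_pos y).
rewrite <- (sqrt_Rsqr (Rabs x + Rabs y)) by lra.
apply sqrt_le_1_alt; unfold Rsqr.
rewrite <- (pow2_abs x), <- (pow2_abs y); nra.
Qed.

Lemma im_le_Cmod (w : C) : Rabs (Im w) <= Cmod w.
Proof.
apply Rle_trans with (2 := Rmax_Cmod w), Rmax_r.
Qed.

(** For [w = x + iy] the real part of the remainder is [exp x * (cos y - 1) + (exp x - 1 - x)] and
    the imaginary part is [exp x * (sin y - y) + (exp x - 1) * y]. Each of these four pieces is at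
    most [exp r * r ^ 2] with [r = Cmod w], whence the constant 4. *)
Lemma Cexp_bound (w : C) :
  Cmod (Cexp w - 1 - w) <= 4 * exp (Cmod w) * Cmod w ^ 2.
Proof.
pose proof (Cmod_le_sum (Cexp w - 1 - w)) as H0.
pose proof (re_le_Cmod w) as Hx; pose proof (im_le_Cmod w) as Hy.
set (r := Cmod w) in *.
destruct w as [x y]; unfold Re, Im, Cexp in *; cbn -[exp cos sin Cmod] in *.
replace (exp x * cos y - 0 * sin y + - (1) + - x) with (exp x * (cos y - 1) + (exp x - 1 - x)) in H0 by ring.
replace (exp x * sin y + 0 * cos y + - 0 + - y) with (exp x * (sin y - y) + (exp x - 1) * y) in H0 by ring.
pose proof (exp_minus_1_minus_bound x) as E2.
pose proof (exp_minus_1_bound x) as E1.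
pose proof (cos_minus_1_bound y) as C1.
pose proof (sin_minus_id_bound y) as S1.
assert (Ex : exp (Rabs x) <= exp r) by (apply exp_le; lra).
assert (Ex' : exp x <= exp r) by (apply exp_le; pose proof (Rle_abs x); lra).
pose proof (exp_pos x) as P; pose proof (exp_pos (Rabs x)) as P'.
rewrite <- pow2_abs in E2, C1, S1.
pose proof (Rabs_pos x); pose proof (Rabs_pos y).
assert (X2 : Rabs x ^ 2 <= r ^ 2) by (apply pow_incr; lra).
assert (Y2 : Rabs y ^ 2 <= r ^ 2) by (apply pow_incr; lra).
assert (Q : 0 <= r ^ 2) by apply pow2_ge_0.
assert (A1 : Rabs (exp x * (cos y - 1)) <= exp r * r ^ 2).
{ rewrite Rabs_mult, (Rabs_pos_eq (exp x)) by lra.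
  apply Rmult_le_compat; try lra; apply Rabs_pos. }
assert (A2 : Rabs (exp x * (sin y - y)) <= exp r * r ^ 2).
{ rewrite Rabs_mult, (Rabs_pos_eq (exp x)) by lra.
  apply Rmult_le_compat; try lra; apply Rabs_pos. }
assert (A3 : Rabs (exp x - 1 - x) <= exp r * r ^ 2).
{ rewrite Rmult_comm; apply Rle_trans with (1 := E2).
  apply Rmult_le_compat; try lra; apply pow2_ge_0. }
assert (A4 : Rabs ((exp x - 1) * y) <= exp r * r ^ 2).
{ rewrite Rabs_mult; replace (exp r * r ^ 2) with (r * exp r * r) by ring.
  apply Rmult_le_compat; try lra; try apply Rabs_pos.
  apply Rle_trans with (1 := E1), Rmult_le_compat; lra. }
pose proof (Rabs_triang (exp x * (cos y - 1)) (exp x - 1 - x)).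
pose proof (Rabs_triang (exp x * (sin y - y)) ((exp x - 1) * y)).
lra.
Qed.

Lemma Cexp_add (w w' : C) : Cexp (w + w') = (Cexp w * Cexp w')%C.
Proof.
destruct w as [x y], w' as [x' y']; unfold Cexp, Re, Im; simpl.
rewrite exp_plus, cos_plus, sin_plus.
apply injective_projections; simpl; ring.
Qed.

Lemma Cexp_0 : Cexp 0 = 1.
Proof.
unfold Cexp; simpl; rewrite exp_0, cos_0, sin_0.
apply injective_projections; simpl; ring.
Qed.

Lemma Cexp_nz (w : C) : Cexp w <> 0.
Proof.
intros H.
apply C1_nz; rewrite <- Cexp_0, <- (Cplus_opp_r w), Cexp_add, H; ring.
Qed.

Lemma Cexp_opp (w : C) : Cexp (- w) = (/ Cexp w)%C.
Proof.
assert (H : (Cexp w * Cexp (- w) = 1)%C) by (now rewrite <- Cexp_add, Cplus_opp_r, Cexp_0).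
pose proof (Cexp_nz w).
rewrite <- (Cmult_1_l (Cexp (- w))), <- (Cinv_l (Cexp w)), <- Cmult_assoc, H by assumption.
ring.
Qed.

Lemma Cexp_natmul (n : nat) (w : C) : Cexp (RtoC (INR n) * w) = (Cexp w ^ n)%C.
Proof.
induction n as [| n IH].
- simpl; now rewrite Cmult_0_l, Cexp_0.
- rewrite S_INR, RtoC_plus, Cmult_plus_distr_r, Cmult_1_l, Cexp_add, IH, Cpow_S; ring.
Qed.

(** * Limits of complex sequences *)

Lemma filterlim_incr_1 {T : UniformSpace} (u : nat -> T) (l : T) :
  filterlim (fun n => u (S n)) eventually (locally l) ->
  filterlim u eventually (locally l).
Proof.
intros H P HP; destruct (H P HP) as [N HN].
exists (S N); intros [| n] Hn; [lia | apply HN; lia].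
Qed.

(** [C] carries two uniform structures, the product one and the one of the modulus, with the same
    neighbourhoods. Passing between them makes the limit theorems for absolute rings applicable. *)
Lemma filterlim_C_AbsRing {T : Type} (F : (T -> Prop) -> Prop) (u : T -> C) (l : C) :
  filterlim u F (locally (T := C_UniformSpace) l) <->
  filterlim u F (locally (T := AbsRing_UniformSpace C_AbsRing) l).
Proof.
split; intros H P HP; apply H, locally_C, HP.
Qed.

Lemma filterlim_Cmult {T : Type} {F : (T -> Prop) -> Prop} {FF : Filter F}
  (u v : T -> C) (l m : C) :
  filterlim u F (locally (T := C_UniformSpace) l) ->
  filterlim v F (locally (T := C_UniformSpace) m) ->
  filterlim (fun n => (u n * v n)%C) F (locally (T := C_UniformSpace) (l * m)%C).
Proof.
rewrite !filterlim_C_AbsRing; intros Hu Hv.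
apply (filterlim_comp_2 u v Cmult Hu Hv).
apply (filterlim_mult (K := C_AbsRing)).
Qed.

Lemma filterlim_RtoC_0 (u : nat -> R) :
  is_lim_seq u 0 ->
  filterlim (fun n => RtoC (u n)) eventually (locally (T := C_UniformSpace) (RtoC 0)).
Proof.
intros H; apply filterlim_C_AbsRing.
apply (filterlim_norm_zero (K := C_AbsRing) (V := AbsRing_NormedModule C_AbsRing)).
apply is_lim_seq_abs_0 in H.
apply (is_lim_seq_ext (fun n => Rabs (u n)) _ 0); [| exact H].
intros n; symmetry; apply Cmod_R.
Qed.

Lemma is_lim_seq_inv_INR_S : is_lim_seq (fun n => / INR (S n)) 0.
Proof.
apply (is_lim_seq_incr_1 (fun n => / INR n)).
apply (is_lim_seq_inv _ p_infty); [apply is_lim_seq_INR | discriminate].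
Qed.

(** As soon as one limit exists, the point chosen by [epsilon] is a limit too, and limits in a
    normed module are unique. *)
Lemma lim_value_unique {K : AbsRing} {V : NormedModule K} (x0 : V) (u : nat -> V) (l : V) :
  filterlim u eventually (locally l) -> lim_value x0 u = l.
Proof.
intros H; unfold lim_value.
apply (filterlim_locally_unique (F := eventually) u); [| exact H].
exact (epsilon_spec (inhabits x0)
  (fun l : V => filterlim u eventually (locally l)) (ex_intro _ l H)).
Qed.

(* Since [1 + c (1/(n+1) - 1/(n+2)) <= exp (c/(n+1)) / exp (c/(n+2))], the
   numbers [|u n| exp (c/(n+1))] decrease; so [u] is bounded and its increments
   are dominated by a telescoping series. *)
Lemma ex_lim_small_relative_increments (u : nat -> C) (c : R) :
  0 <= c ->
  (forall n, Cmod (u (S n) - u n)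
     <= c * (/ INR (S n) - / INR (S (S n))) * Cmod (u n)) ->
  exists l, filterlim u eventually (locally (T := C_UniformSpace) l).
Proof.
intros Hc H.
set (B := Cmod (u O) * exp c).
assert (Hdec : forall n, Cmod (u n) * exp (c * / INR (S n)) <= B).
{ intros n; induction n as [| n IH].
  - unfold B; simpl INR; rewrite Rinv_1, Rmult_1_r; apply Rle_refl.
  - apply Rle_trans with (2 := IH).
    set (a := c * / INR (S n)); set (b := c * / INR (S (S n))).
    assert (E : Cmod (u (S n)) <= Cmod (u n) * exp (a - b)).
    { pose proof (exp_ineq1_le (a - b)) as E1.
      pose proof (Cmod_triangle (u n) (u (S n) - u n)) as E2.
      replace (u n + (u (S n) - u n))%C with (u (S n)) in E2 by ring.
      specialize (H n); pose proof (Cmod_ge_0 (u n)).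
      replace (c * (/ INR (S n) - / INR (S (S n)))) with (a - b) in H by (unfold a, b; ring).
      nra. }
    replace a with ((a - b) + b) at 1 by ring.
    rewrite exp_plus, <- Rmult_assoc.
    apply Rmult_le_compat_r; [left; apply exp_pos | exact E]. }
assert (Hbound : forall n, Cmod (u n) <= B).
{ intros n; apply Rle_trans with (2 := Hdec n).
  assert (0 <= c * / INR (S n)).
  { apply Rmult_le_pos; [exact Hc | left; apply Rinv_0_lt_compat, lt_0_INR; lia]. }
  pose proof (exp_ineq1_le (c * / INR (S n))); pose proof (Cmod_ge_0 (u n)); nra. }
assert (Hsum : ex_series (K := C_AbsRing) (V := C_NormedModule) (fun n => u (S n) - u n)%C).
{ apply (ex_series_le (K := C_AbsRing) (V := C_CompleteNormedModule) _
    (fun n => c * B * (/ INR (S n) - / INR (S (S n))))).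
  - intros n; change (Cmod (u (S n) - u n) <= c * B * (/ INR (S n) - / INR (S (S n)))).
    apply Rle_trans with (1 := H n).
    assert (/ INR (S (S n)) <= / INR (S n)).
    { apply Rinv_le_contravar; [apply lt_0_INR; lia | apply le_INR; lia]. }
    specialize (Hbound n).
    replace (c * B * (/ INR (S n) - / INR (S (S n))))
      with (c * (/ INR (S n) - / INR (S (S n))) * B) by ring.
    apply Rmult_le_compat_l; [apply Rmult_le_pos; lra | exact Hbound].
  - apply (ex_series_scal (K := R_AbsRing) (V := R_NormedModule) (c * B)).
    (* The telescoping sum up to [n] is [1 - / INR (S (S n))], as its first term starts from
       [/ INR 1 = 1]. *)
    exists 1.
    apply (is_lim_seq_ext (fun n => 1 - / INR (S (S n))) _ 1).
    + intros n; induction n as [| n IH].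
      * rewrite sum_O; simpl; field.
      * rewrite sum_Sn, <- IH; unfold plus; simpl plus; cbn -[INR]; ring.
    + replace (Finite 1) with (Finite (1 - 0)) by (f_equal; ring).
      apply is_lim_seq_minus'; [apply is_lim_seq_const |].
      apply (is_lim_seq_incr_1 (fun n => / INR (S n))), is_lim_seq_inv_INR_S. }
destruct Hsum as [l Hl]; exists (u O + l)%C.
apply filterlim_incr_1.
apply filterlim_ext with (f := fun n => plus (G := C_NormedModule) (u O)
  (sum_n (G := C_NormedModule) (fun n => u (S n) - u n)%C n)).
- intros n; induction n as [| n IH].
  + rewrite sum_O; change (u O + (u 1%nat - u O) = u 1%nat)%C; ring.
  + rewrite sum_Sn, plus_assoc, IH.
    change (u (S n) + (u (S (S n)) - u (S n)) = u (S (S n)))%C; ring.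
- refine (filterlim_comp_2 _ _ (plus (G := C_NormedModule)) (filterlim_const _) Hl _).
  apply (filterlim_plus (K := C_AbsRing) (V := C_NormedModule)).
Qed.

(** * Convergence of Gauss' product and the functional equation of 1/Gamma *)

Definition Gauss_quotient (z : C) (n : nat) : C :=
  (rising z (S n) / (RtoC (INR (fact n)) * Cexp (z * RtoC (ln (INR n)))))%C.

Lemma RtoC_INR_nz (n : nat) : n <> 0%nat -> RtoC (INR n) <> 0.
Proof.
intros Hn E; apply RtoC_inj in E; exact (not_0_INR n Hn E).
Qed.

Lemma Gauss_quotient_S (z : C) (n : nat) :
  n <> 0%nat ->
  Gauss_quotient z (S n)
  = (Gauss_quotient z n * ((1 + z * RtoC (/ INR (S n)))
     * Cexp (- (z * RtoC (ln (INR (S n)) - ln (INR n))))))%C.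
Proof.
intros Hn; unfold Gauss_quotient.
replace (rising z (S (S n))) with (rising z (S n) * (z + RtoC (INR (S n))))%C by reflexivity.
rewrite fact_simpl, mult_INR, RtoC_mult, RtoC_minus, RtoC_inv by (apply not_0_INR; lia).
replace (- (z * (RtoC (ln (INR (S n))) - RtoC (ln (INR n)))))%C
  with (- (z * RtoC (ln (INR (S n)))) + z * RtoC (ln (INR n)))%C by ring.
rewrite Cexp_add, Cexp_opp.
field; repeat split; try apply Cexp_nz; apply RtoC_INR_nz; try apply fact_neq_0; lia.
Qed.

(** Both sides come from [ln x <= x - 1], at [x = n/(n+1)] and at [x = (n+1)/n]. *)
Lemma ln_increment_bounds (n : nat) :
  n <> 0%nat ->
  / INR (S n) <= ln (INR (S n)) - ln (INR n) <= / INR n.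
Proof.
intros Hn.
assert (P : 0 < INR n) by (apply lt_0_INR; lia).
assert (Q : 0 < INR (S n)) by (apply lt_0_INR; lia).
assert (Hln : forall x, 0 < x -> ln x <= x - 1).
{ intros x Hx; pose proof (exp_ineq1_le (ln x)) as E; rewrite exp_ln in E by exact Hx; lra. }
split.
- pose proof (Hln (INR n / INR (S n)) (Rdiv_lt_0_compat _ _ P Q)) as E.
  rewrite ln_div in E by assumption.
  replace (INR n / INR (S n) - 1) with (- / INR (S n)) in E by (rewrite S_INR in *; field; lra).
  lra.
- pose proof (Hln (INR (S n) / INR n) (Rdiv_lt_0_compat _ _ Q P)) as E.
  rewrite ln_div in E by assumption.
  replace (INR (S n) / INR n - 1) with (/ INR n) in E by (rewrite S_INR in *; field; lra).
  lra.
Qed.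

(** With [t = 1/(n+1)] and [a = ln (n+1) - ln n], the first-order terms [z t] and [- z a] nearly
    cancel, since [a] lies between [t] and [s = 1/n]; what remains is of order [s t = s - t]. This
    is the telescoping form that [ex_lim_small_relative_increments] asks for. *)
Lemma Gauss_factor_bound (z : C) :
  exists c, 0 <= c /\ forall n, n <> 0%nat ->
  Cmod ((1 + z * RtoC (/ INR (S n)))
        * Cexp (- (z * RtoC (ln (INR (S n)) - ln (INR n)))) - 1)
  <= c * (/ INR n - / INR (S n)).
Proof.
set (r := Cmod z).
assert (Hr : 0 <= r) by apply Cmod_ge_0.
pose proof (exp_pos r) as Pe.
(* The three summands bound the remainder of [Cexp], the term [z (t - a)] and the term [z^2 t a]. In
   the first, [1 + r] bounds [1 + z t], [4 exp r r^2] comes from [Cexp_bound], and the factor 2 from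
   [a^2 <= s^2 <= 2 s t]. *)
exists (2 * (1 + r) * (4 * exp r * r ^ 2) + r + r ^ 2).
split.
{ pose proof (pow2_ge_0 r) as Q.
  pose proof (Rmult_le_pos _ _ (Rlt_le _ _ Pe) Q) as Q1.
  pose proof (Rmult_le_pos _ _ Hr Q1); lra. }
intros n Hn.
destruct (ln_increment_bounds n Hn) as [Ha1 Ha2].
set (a := ln (INR (S n)) - ln (INR n)) in *.
assert (P : 1 <= INR n) by (apply (le_INR 1); lia).
assert (Ht : / INR n - / INR (S n) = / INR n * / INR (S n)) by (rewrite S_INR; field; lra).
assert (Hs1 : / INR n <= 1) by (rewrite <- Rinv_1; apply Rinv_le_contravar; lra).
assert (Ht0 : 0 < / INR (S n)) by (apply Rinv_0_lt_compat, lt_0_INR; lia).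
assert (Hs2 : / INR n <= 2 * / INR (S n)).
{ rewrite S_INR; apply Rmult_le_reg_r with (INR n * (INR n + 1)); [nra |].
  field_simplify; lra. }
set (s := / INR n) in *; set (t := / INR (S n)) in *.
set (w := (- (z * RtoC a))%C).
assert (Hw : Cmod w = r * a).
{ unfold w; rewrite Cmod_opp, Cmod_mult, Cmod_R, Rabs_pos_eq by lra; reflexivity. }
(* Write [Cexp w] as [(Cexp w - 1 - w) + (1 + w)] and expand [(1 + z t) (1 + w) - 1] with
   [w = - z a]. *)
replace ((1 + z * RtoC t) * Cexp w - 1)%C
  with ((1 + z * RtoC t) * (Cexp w - 1 - w) + (z * RtoC (t - a) + (z * z) * - RtoC (t * a)))%C
  by (unfold w; rewrite RtoC_minus, RtoC_mult; ring).
apply Rle_trans with (1 := Cmod_triangle _ _).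
assert (A1 : Cmod ((1 + z * RtoC t) * (Cexp w - 1 - w)) <= (1 + r) * ((4 * exp r * r ^ 2) * (2 * (s * t)))).
{ rewrite Cmod_mult; apply Rmult_le_compat; try apply Cmod_ge_0.
  - apply Rle_trans with (1 := Cmod_triangle _ _).
    rewrite Cmod_1, Cmod_mult, Cmod_R, Rabs_pos_eq by lra; fold r; nra.
  - apply Rle_trans with (1 := Cexp_bound w).
    rewrite Hw, Rpow_mult_distr, <- Rmult_assoc.
    assert (exp (r * a) <= exp r) by (apply exp_le; nra).
    pose proof (pow2_ge_0 r).
    apply Rmult_le_compat; [| apply pow2_ge_0 | | nra].
    + pose proof (exp_pos (r * a)); nra.
    + nra. }
assert (A2 : Cmod (z * RtoC (t - a)) <= r * (s * t)).
{ rewrite Cmod_mult, Cmod_R, Rabs_left1 by lra; fold r; nra. }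
assert (A3 : Cmod (z * z * - RtoC (t * a)) <= r ^ 2 * (s * t)).
{ rewrite !Cmod_mult, Cmod_opp, Cmod_R, Rabs_pos_eq by nra; fold r.
  replace (r ^ 2) with (r * r) by ring.
  apply Rmult_le_compat_l; nra. }
pose proof (Cmod_triangle (z * RtoC (t - a)) (z * z * - RtoC (t * a))).
rewrite Ht; lra.
Qed.

(** Existence of the limit is what makes the choice inside [inv_Gamma] a genuine limit. *)
Lemma inv_Gamma_correct (z : C) :
  filterlim (Gauss_quotient z) eventually (locally (T := C_UniformSpace) (inv_Gamma z)).
Proof.
assert (H : exists l, filterlim (Gauss_quotient z) eventually (locally (T := C_UniformSpace) l)).
{ destruct (Gauss_factor_bound z) as [c [Hc H]].
  (* The sequence is shifted by one because the quotient of successive terms involves [ln n] and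
     [1/n], hence is controlled from [n = 1] on. *)
  destruct (ex_lim_small_relative_increments (fun n => Gauss_quotient z (S n)) c Hc) as [l Hl].
  - intros n; rewrite (Gauss_quotient_S z (S n)) by lia.
    specialize (H (S n) (Nat.neq_succ_0 n)).
    match type of H with Cmod (?f - _) <= _ =>
      replace (Gauss_quotient z (S n) * f - Gauss_quotient z (S n))%C
        with (Gauss_quotient z (S n) * (f - 1))%C by ring end.
    rewrite Cmod_mult, Rmult_comm.
    apply Rmult_le_compat_r; [apply Cmod_ge_0 | exact H].
  - exists l; now apply filterlim_incr_1. }
destruct H as [l Hl].
change (inv_Gamma z) with (lim_value (T := C_UniformSpace) (RtoC 0) (Gauss_quotient z)).
now rewrite (lim_value_unique (V := C_NormedModule) _ _ _ Hl).
Qed.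

Lemma rising_S_l (z : C) (n : nat) : rising z (S n) = (z * rising (z + 1) n)%C.
Proof.
induction n as [| n IH].
- simpl; ring.
- change (rising z (S (S n))) with (rising z (S n) * (z + RtoC (INR (S n))))%C.
  rewrite IH, S_INR, RtoC_plus; simpl; ring.
Qed.

(** The numerator [z * rising (z + 1) (S n)] is [rising z (S n)] with the extra factor [z + n + 1],
    while [n^(z+1)] brings an extra [n]; their ratio is [1 + (z + 1)/n]. *)
Lemma Gauss_quotient_shift (z : C) (n : nat) :
  n <> 0%nat ->
  (z * Gauss_quotient (z + 1) n
   = Gauss_quotient z n * (1 + (z + 1) * RtoC (/ INR n)))%C.
Proof.
intros Hn; unfold Gauss_quotient.
replace ((z + 1) * RtoC (ln (INR n)))%C
  with (z * RtoC (ln (INR n)) + RtoC (ln (INR n)))%C by ring.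
rewrite Cexp_add.
assert (E : Cexp (RtoC (ln (INR n))) = RtoC (INR n)).
{ unfold Cexp; simpl; rewrite exp_ln by (apply lt_0_INR; lia).
  rewrite cos_0, sin_0; apply injective_projections; simpl; ring. }
rewrite E, RtoC_inv by (apply not_0_INR; exact Hn).
replace (z * (rising (z + 1) (S n) / (RtoC (INR (fact n)) * (Cexp (z * RtoC (ln (INR n))) * RtoC (INR n)))))%C
  with (rising z (S (S n)) / (RtoC (INR (fact n)) * (Cexp (z * RtoC (ln (INR n))) * RtoC (INR n))))%C
  by (rewrite (rising_S_l z (S n)); unfold Cdiv; ring).
change (rising z (S (S n))) with (rising z (S n) * (z + RtoC (INR (S n))))%C.
rewrite S_INR, RtoC_plus.
field; repeat split; try apply Cexp_nz; apply RtoC_INR_nz; try apply fact_neq_0; exact Hn.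
Qed.

(** Let [n] tend to infinity in [Gauss_quotient_shift]: the correcting factor tends to 1, and the
    two expressions of the same sequence have the same limit. *)
Lemma inv_Gamma_functional_equation (z : C) :
  inv_Gamma z = (z * inv_Gamma (z + 1))%C.
Proof.
apply (filterlim_locally_unique (K := C_AbsRing) (V := C_NormedModule) (F := eventually)
  (fun n => z * Gauss_quotient (z + 1) n)%C).
- apply filterlim_incr_1.
  apply filterlim_ext with
    (f := fun n => (Gauss_quotient z (S n) * (1 + (z + 1) * RtoC (/ INR (S n))))%C).
  + intros n; now rewrite Gauss_quotient_shift by lia.
  + replace (inv_Gamma z) with (inv_Gamma z * (1 + (z + 1) * 0))%C by ring.
    apply filterlim_Cmult.
    * apply (filterlim_comp _ _ _ S _ _ eventually); [| apply inv_Gamma_correct].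
      apply eventually_subseq; lia.
    * refine (filterlim_comp_2 _ _ Cplus (filterlim_const _) _ _).
      -- apply filterlim_Cmult; [apply filterlim_const |].
         apply filterlim_RtoC_0, is_lim_seq_inv_INR_S.
      -- apply (filterlim_plus (K := C_AbsRing) (V := C_NormedModule)).
- apply filterlim_Cmult; [apply filterlim_const | apply inv_Gamma_correct].
Qed.

(** * Bounds for the Bessel coefficients and convergence of the classical series *)

Lemma bounded_of_eventually_decreasing (u : nat -> R) (N : nat) :
  (forall n, (N <= n)%nat -> u (S n) <= u n) -> exists B, forall n, u n <= B.
Proof.
revert u; induction N as [| N IH]; intros u H.
- exists (u O); intros n; induction n as [| n IHn]; [lra |].
  specialize (H n (Nat.le_0_l n)); lra.
- destruct (IH (fun n => u (S n))) as [B HB]; [intros n Hn; apply H; lia |].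
  exists (Rmax (u O) B); intros [| n]; [apply Rmax_l |].
  apply Rle_trans with (1 := HB n), Rmax_r.
Qed.

Lemma inv_Gamma_shift_bounded (nu : C) :
  exists B, forall n, Cmod (inv_Gamma (nu + RtoC (INR n) + 1)) <= B.
Proof.
(* For [n >= N] the modulus of [nu + n + 1] is at least [n - Cmod (nu + 1) >= 1], so the functional
   equation makes the moduli decrease from [N] on. *)
destruct (INR_unbounded (Cmod (nu + 1) + 1)) as [N HN].
apply (bounded_of_eventually_decreasing _ N); intros n Hn.
rewrite (inv_Gamma_functional_equation (nu + RtoC (INR n) + 1)), Cmod_mult.
rewrite S_INR, RtoC_plus.
replace (nu + (RtoC (INR n) + 1) + 1)%C with (nu + RtoC (INR n) + 1 + 1)%C by ring.
set (g := Cmod (inv_Gamma _)).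
assert (Hg : 0 <= g) by apply Cmod_ge_0.
assert (1 <= Cmod (nu + RtoC (INR n) + 1)); [| nra].
pose proof (Cmod_triangle (nu + RtoC (INR n) + 1) (- (nu + 1))) as E.
rewrite Cmod_opp in E.
replace (nu + RtoC (INR n) + 1 + - (nu + 1))%C with (RtoC (INR n)) in E by ring.
rewrite Cmod_R, Rabs_pos_eq in E by apply pos_INR.
apply le_INR in Hn; lra.
Qed.

Definition BesselJ_coef (nu : C) (n : nat) : C :=
  ((- (1)) ^ n / (RtoC (INR (fact n)) * Gamma (nu + RtoC (INR n) + 1)))%C.

(** The factor [b] may vanish: it will be [Gamma] at a pole, whose value here is [/ 0 = 0]. *)
Lemma Cinv_mult_nz_l (a b : C) : a <> 0 -> (/ (a * b) = / a * / b)%C.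
Proof.
intros Ha; destruct (Ceq_dec b 0) as [-> | Hb].
- now rewrite Cmult_0_r, !Cinv_0, Cmult_0_r.
- now field.
Qed.

Lemma BesselJ_coef_bound (nu : C) :
  exists B, forall n, Cmod (BesselJ_coef nu n) <= B * / INR (fact n).
Proof.
destruct (inv_Gamma_shift_bounded nu) as [B HB]; exists B; intros n.
unfold BesselJ_coef, Cdiv.
rewrite Cinv_mult_nz_l, Cinv_Gamma by (apply RtoC_INR_nz, fact_neq_0).
rewrite <- RtoC_inv by apply INR_fact_neq_0.
rewrite !Cmod_mult, Cmod_pow, Cmod_m1, pow1, Cmod_R.
pose proof (Rinv_0_lt_compat _ (INR_fact_lt_0 n)).
rewrite Rabs_pos_eq by lra.
specialize (HB n); nra.
Qed.

Lemma ex_series_BesselJ_coef (nu : C) (r : R) :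
  0 <= r -> ex_series (fun n => Cmod (BesselJ_coef nu n) * r ^ n).
Proof.
intros Hr; destruct (BesselJ_coef_bound nu) as [B HB].
(* The majorant is [B] times the exponential series at [r]. *)
apply (ex_series_le (K := R_AbsRing) (V := R_CompleteNormedModule) _
  (fun n => scal B (scal (pow_n r n) (/ INR (fact n))))).
- intros n; change (Rabs (Cmod (BesselJ_coef nu n) * r ^ n) <= B * (r ^ n * / INR (fact n))).
  pose proof (pow_le r n Hr).
  pose proof (Cmod_ge_0 (BesselJ_coef nu n)).
  rewrite Rabs_pos_eq by (now apply Rmult_le_pos).
  replace (B * (r ^ n * / INR (fact n))) with (B * / INR (fact n) * r ^ n) by ring.
  apply Rmult_le_compat_r; [assumption | apply HB].
- apply (ex_series_scal (K := R_AbsRing) (V := R_NormedModule)).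
  exists (exp r); apply is_exp_Reals.
Qed.

Lemma Cexp_natmul_log (L : C -> C) (w : C) (n : nat) :
  is_log_branch L -> w <> 0 ->
  Cexp (2 * RtoC (INR n) * L w) = (w ^ (2 * n))%C.
Proof.
intros HL Hw.
replace (2 * RtoC (INR n))%C with (RtoC (INR (2 * n))) by (now rewrite mult_INR, RtoC_mult).
now rewrite Cexp_natmul, HL.
Qed.

Lemma Cpower_nz (L : C -> C) (z nu : C) : z <> 0 -> Cpower L z nu = Cexp (nu * L z).
Proof.
intros Hz; unfold Cpower; now destruct (Ceq_dec z 0).
Qed.

(** Growth at most geometric in [n] suffices, the coefficients being [O(1/n!)]. For [w <> 0] the
    power splits as [w^(2n)] times the fixed number [Cexp (nu * L w)]. *)
Lemma Cpower_shift_bound (L : C -> C) (w nu : C) :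
  is_log_branch L ->
  exists K r, 0 <= r /\ forall n,
    Cmod (Cpower L w (2 * RtoC (INR n) + nu)) <= K * r ^ n.
Proof.
intros HL; destruct (Ceq_dec w 0) as [-> | Hw].
(* At the base 0 every power is 0 or 1; the value 1 occurs when [nu = - 2 n]. *)
- exists 1, 1; split; [lra |]; intros n; unfold Cpower; rewrite pow1.
  destruct (Ceq_dec 0 0) as [_ | []]; [| easy].
  destruct (Ceq_dec _ 0); rewrite ?Cmod_1, ?Cmod_0; lra.
- exists (Cmod (Cexp (nu * L w))), (Cmod w ^ 2); split; [apply pow2_ge_0 |]; intros n.
  rewrite Cpower_nz, Cmult_plus_distr_r, Cexp_add, Cexp_natmul_log by assumption.
  rewrite Cmod_mult, Cmod_pow, pow_mult, Rmult_comm; apply Rle_refl.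
Qed.

Lemma ex_series_BesselJ_term (L : C -> C) (nu z : C) :
  is_log_branch L ->
  ex_series (K := C_AbsRing) (V := C_NormedModule) (BesselJ_term L nu z).
Proof.
intros HL; destruct (Cpower_shift_bound L (z / 2) nu HL) as [K [r [Hr H]]].
apply (ex_series_le (K := C_AbsRing) (V := C_CompleteNormedModule) _
  (fun n => K * (Cmod (BesselJ_coef nu n) * r ^ n))).
- intros n; change (Cmod (BesselJ_coef nu n * Cpower L (z / 2) (2 * RtoC (INR n) + nu))
    <= K * (Cmod (BesselJ_coef nu n) * r ^ n)).
  rewrite Cmod_mult.
  replace (K * (Cmod (BesselJ_coef nu n) * r ^ n))
    with (Cmod (BesselJ_coef nu n) * (K * r ^ n)) by ring.
  apply Rmult_le_compat_l; [apply Cmod_ge_0 | apply H].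
- apply (ex_series_scal (K := R_AbsRing) (V := R_NormedModule) K).
  now apply ex_series_BesselJ_coef.
Qed.

(** * Bicomplex operations in idempotent coordinates *)

Lemma CtoBC_idem (z : C) : CtoBC z = idem z z.
Proof.
destruct z as [a b].
apply injective_projections; apply injective_projections; simpl; field.
Qed.

Lemma idem_plus (z1 z2 w1 w2 : C) :
  (idem z1 z2 + idem w1 w2)%BC = idem (z1 + w1) (z2 + w2).
Proof.
destruct z1 as [a b], z2 as [c d], w1 as [a' b'], w2 as [c' d'].
apply injective_projections; apply injective_projections; simpl; field.
Qed.

Lemma idem_opp (z1 z2 : C) : (- idem z1 z2)%BC = idem (- z1) (- z2).
Proof.
destruct z1 as [a b], z2 as [c d].
apply injective_projections; apply injective_projections; simpl; field.
Qed.

Lemma idem_inv (z1 z2 : C) : BCinv (idem z1 z2) = idem (/ z1) (/ z2).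
Proof.
unfold BCinv; now rewrite idem1_idem, idem2_idem.
Qed.

Lemma idem_pow_nat (z1 z2 : C) (n : nat) :
  BCpow_nat (idem z1 z2) n = idem (z1 ^ n) (z2 ^ n).
Proof.
induction n as [| n IH]; [apply CtoBC_idem |].
simpl BCpow_nat; now rewrite IH, idem_mult.
Qed.

Lemma idem_power (L : C -> C) (z1 z2 nu1 nu2 : C) :
  BCpower L (idem z1 z2) (idem nu1 nu2) = idem (Cpower L z1 nu1) (Cpower L z2 nu2).
Proof.
unfold BCpower; now rewrite !idem1_idem, !idem2_idem.
Qed.

(** [BCinv] inverts each component with [/ 0 = 0], so the identity persists when only one component
    meets a pole of Gamma. *)
Lemma BesselJ_b_coef_idem (nu1 nu2 : C) (s : nat) :
  BesselJ_b_coef (idem nu1 nu2) s = idem (BesselJ_coef nu1 s) (BesselJ_coef nu2 s).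
Proof.
unfold BesselJ_b_coef, Gamma_b, BCnat.
rewrite !CtoBC_idem, idem_opp, idem_pow_nat, !idem_plus, idem1_idem, idem2_idem.
rewrite idem_mult, idem_inv, idem_mult.
unfold BesselJ_coef, Cdiv.
now rewrite !(Cmult_comm (Gamma _)).
Qed.

Lemma BesselJ_b_term_idem (L : C -> C) (z1 z2 nu1 nu2 : C) (s : nat) :
  BesselJ_b_term L (idem nu1 nu2) (idem z1 z2) s
  = idem (BesselJ_term L nu1 z1 s) (BesselJ_term L nu2 z2 s).
Proof.
unfold BesselJ_b_term, BCnat.
rewrite BesselJ_b_coef_idem, !CtoBC_idem, idem_inv, !idem_mult, idem_plus, idem_power, idem_mult.
unfold BesselJ_term; now rewrite (Cplus_comm nu1), (Cplus_comm nu2).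
Qed.

Lemma BesselJ_b_normalized_term_idem (L : C -> C) (z1 z2 nu1 nu2 : C) (s : nat) :
  BesselJ_b_normalized_term L (idem nu1 nu2) (idem z1 z2) s
  = idem (Cpower L 2 (- nu1) * (BesselJ_coef nu1 s * (z1 / 2) ^ (2 * s)))
         (Cpower L 2 (- nu2) * (BesselJ_coef nu2 s * (z2 / 2) ^ (2 * s))).
Proof.
unfold BesselJ_b_normalized_term.
now rewrite BesselJ_b_coef_idem, !CtoBC_idem, idem_inv, idem_opp, idem_power,
  idem_mult, idem_pow_nat, !idem_mult.
Qed.

(** * Convergence and sums of bicomplex series *)

Lemma is_series_pair (a b : nat -> C) (l m : C) :
  is_series (K := C_AbsRing) (V := C_NormedModule) a l ->
  is_series (K := C_AbsRing) (V := C_NormedModule) b m ->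
  is_series (K := C_AbsRing) (V := BC_NormedModule) (fun n => (a n, b n)) (l, m).
Proof.
intros Ha Hb; unfold is_series in *.
apply filterlim_locally; intros eps.
apply (filterlim_locally (U := C_UniformSpace)) with (eps := eps) in Ha.
apply (filterlim_locally (U := C_UniformSpace)) with (eps := eps) in Hb.
apply filter_imp with (2 := filter_and _ _ Ha Hb).
intros n [H1 H2].
assert (E : sum_n (G := BC_NormedModule) (fun n => (a n, b n)) n
  = (sum_n (G := C_NormedModule) a n, sum_n (G := C_NormedModule) b n)).
{ clear; induction n as [| n IH]; [now rewrite !sum_O |].
  now rewrite !sum_Sn, IH. }
rewrite E; now split.
Qed.

Lemma is_series_idem (a b : nat -> C) (l m : C) :
  is_series (K := C_AbsRing) (V := C_NormedModule) a l ->
  is_series (K := C_AbsRing) (V := C_NormedModule) b m ->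
  is_series (K := C_AbsRing) (V := BC_NormedModule)
    (fun n => idem (a n) (b n)) (idem l m).
Proof.
intros Ha Hb.
(* Since [BCe1 = (1/2, i/2)] and [BCe2 = (1/2, -i/2)], both coordinates of [idem z w] are linear in
   [z] and [w], so linearity of series applies to each. *)
assert (E : forall z w, idem z w = (/ 2 * (z + w), Ci / 2 * (z + - w))%C).
{ intros [x y] [x' y'].
  apply injective_projections; apply injective_projections; simpl; field. }
rewrite E; apply is_series_ext with (fun n => (/ 2 * (a n + b n), Ci / 2 * (a n + - b n))%C).
{ intros n; now rewrite E. }
apply is_series_pair.
- apply (is_series_scal (K := C_AbsRing) (V := C_NormedModule) (/ 2)%C).
  now apply (is_series_plus (K := C_AbsRing) (V := C_NormedModule)).
- apply (is_series_scal (K := C_AbsRing) (V := C_NormedModule) (Ci / 2)%C).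
  apply (is_series_plus (K := C_AbsRing) (V := C_NormedModule)); [assumption |].
  now apply (is_series_opp (K := C_AbsRing) (V := C_NormedModule)).
Qed.

Lemma sum_series_unique {K : AbsRing} {V : NormedModule K} (a : nat -> V) (l : V) :
  is_series a l -> sum_series a = l.
Proof.
intros H; exact (lim_value_unique zero (sum_n a) l H).
Qed.

Lemma ex_series_normalized_norm (nu w c : C) :
  ex_series (K := C_AbsRing) (V := C_NormedModule)
    (fun n => RtoC (Cmod (c * (BesselJ_coef nu n * w ^ (2 * n))))).
Proof.
apply (ex_series_le (K := C_AbsRing) (V := C_CompleteNormedModule) _
  (fun n => Cmod c * (Cmod (BesselJ_coef nu n) * (Cmod w ^ 2) ^ n))).
- intros n.
  change (Cmod (RtoC (Cmod (c * (BesselJ_coef nu n * w ^ (2 * n)))))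
    <= Cmod c * (Cmod (BesselJ_coef nu n) * (Cmod w ^ 2) ^ n)).
  rewrite Cmod_R, Rabs_pos_eq by apply Cmod_ge_0.
  rewrite !Cmod_mult, Cmod_pow, pow_mult; apply Rle_refl.
- apply (ex_series_scal (K := R_AbsRing) (V := R_NormedModule)).
  apply ex_series_BesselJ_coef, pow2_ge_0.
Qed.

(** The factor [(z/2)^(2s)] is the same for every branch, so all rests on
    [z^(-nu) (z/2)^nu = 2^(-nu)]. The assumption on [L (z / 2)] secures this, as a branch cut may
    otherwise leave a factor [exp (2 pi i m nu)] with [m] an integer. *)
Lemma BesselJ_term_normalized (L : C -> C) (nu z : C) (s : nat) :
  is_log_branch L -> z <> 0 -> L (z / 2)%C = (L z - L 2)%C ->
  (Cpower L z (- nu) * BesselJ_term L nu z s)%C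
  = (Cpower L 2 (- nu) * (BesselJ_coef nu s * (z / 2) ^ (2 * s)))%C.
Proof.
intros HL Hz HLz.
assert (H2 : RtoC 2 <> 0) by (intros E; apply RtoC_inj in E; lra).
assert (Hz2 : (z / 2)%C <> 0).
{ intros E; apply Hz; replace z with (z / 2 * 2)%C by (now field); rewrite E; ring. }
unfold BesselJ_term; fold (BesselJ_coef nu s).
rewrite !Cpower_nz by assumption.
rewrite Cmult_plus_distr_r, Cexp_add, Cexp_natmul_log by assumption.
assert (E : Cexp (- nu * L 2) = (Cexp (- nu * L z) * Cexp (nu * L (z / 2)))%C).
{ rewrite <- Cexp_add, HLz; f_equal; ring. }
rewrite E; ring.
Qed.

(** Convergence accompanies the value of [BesselJ_b], since [sum_series] is arbitrary on a divergent
    series. The termwise identity justifies calling the normalized series that of [Z^(-V) J_V(Z)]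
    where the logarithms are compatible; absolute convergence is claimed also at zero components. *)
Theorem theorem2p1 :
  forall (L : C -> C), is_log_branch L ->
  forall (z1 z2 nu1 nu2 : C) (Z V : BC),
    Z = (CtoBC z1 * BCe1 + CtoBC z2 * BCe2)%BC ->
    V = (CtoBC nu1 * BCe1 + CtoBC nu2 * BCe2)%BC ->
    (ex_series (K := C_AbsRing) (V := BC_NormedModule) (BesselJ_b_term L V Z)
     /\ BesselJ_b L V Z =
          (CtoBC (BesselJ L nu1 z1) * BCe1
           + CtoBC (BesselJ L nu2 z2) * BCe2)%BC)
    /\ ((forall s : nat,
           z1 <> RtoC 0 -> z2 <> RtoC 0 ->
           L (z1 / RtoC 2)%C = (L z1 - L (RtoC 2))%C ->
           L (z2 / RtoC 2)%C = (L z2 - L (RtoC 2))%C ->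
           (BCpower L Z (- V) * BesselJ_b_term L V Z s)%BC
           = BesselJ_b_normalized_term L V Z s)
        /\ abs_converges_h (BesselJ_b_normalized_term L V Z)).
Proof.
intros L HL z1 z2 nu1 nu2 Z V HZ HV.
fold (idem z1 z2) in HZ; fold (idem nu1 nu2) in HV; subst Z V.
fold (idem (BesselJ L nu1 z1) (BesselJ L nu2 z2)).
destruct (ex_series_BesselJ_term L nu1 z1 HL) as [l1 H1].
destruct (ex_series_BesselJ_term L nu2 z2 HL) as [l2 H2].
(* One convergence statement with an explicit limit yields both the existence of the sum and its
   idempotent form. *)
assert (H : is_series (K := C_AbsRing) (V := BC_NormedModule)
  (BesselJ_b_term L (idem nu1 nu2) (idem z1 z2)) (idem l1 l2)).
{ apply is_series_ext with (2 := is_series_idem _ _ _ _ H1 H2).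
  intros n; symmetry; apply BesselJ_b_term_idem. }
split; split.
- now exists (idem l1 l2).
- unfold BesselJ_b, BesselJ.
  now rewrite (sum_series_unique _ _ H), (sum_series_unique (V := C_NormedModule) _ _ H1),
    (sum_series_unique (V := C_NormedModule) _ _ H2).
- intros s Hz1 Hz2 HL1 HL2.
  rewrite BesselJ_b_term_idem, BesselJ_b_normalized_term_idem, idem_opp, idem_power, idem_mult.
  now rewrite !BesselJ_term_normalized.
- destruct (ex_series_normalized_norm nu1 (z1 / 2) (Cpower L 2 (- nu1))) as [m1 N1].
  destruct (ex_series_normalized_norm nu2 (z2 / 2) (Cpower L 2 (- nu2))) as [m2 N2].
  exists (idem m1 m2).
  apply is_series_ext with (2 := is_series_idem _ _ _ _ N1 N2).
  intros n; rewrite BesselJ_b_normalized_term_idem.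
  unfold BCnorm_h; now rewrite idem1_idem, idem2_idem.
Qed.
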